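(* There is a function $\eta(n)\to 0$ (as $n\to\infty$) such that every Steiner triple system $S$ of order $n$ has at most \[ \left((1+\eta(n))\frac{n}{2e^{2}}\right)^{n/3} \] perfect matchings.
   Context: A Steiner triple system of order $n$ is a 3-uniform hypergraph on the vertex set $[n]$ such that every pair of vertices is contained in exactly one hyperedge. A perfect matching is a set of pairwise disjoint hyperedges covering all vertices. *)

(* Defs.v *)
From mathcomp Require Import all_boot.
From Stdlib Require Import Reals.

Set Implicit Arguments.
Unset Strict Implicit.
Unset Printing Implicit Defensive.

Definition steiner_triple_system (n : nat) (S : {set {set 'I_n}}) : Prop :=
  (forall e, e \in S -> #|e| = 3) /\
  (forall x y : 'I_n, x != y ->
     #|[set e in S | (x \in e) && (y \in e)]| = 1).

Definition perfect_matching (n : nat) (S M : {set {set 'I_n}}) : bool :=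
  [&& M \subset S, trivIset M & cover M == [set: 'I_n]].

Definition num_perfect_matchings (n : nat) (S : {set {set 'I_n}}) : nat :=
  #|[set M : {set {set 'I_n}} | perfect_matching S M]|.

(* Main.v *)
(* Let [M] be a uniformly random perfect matching of [S] and let every vertex receive an
   independent random time in [{0, .., T - 1}]. The blocks of [M] are revealed vertex by
   vertex in the order of the times; by the chain rule, the entropy [ln N] of [M] is at most
   the expected sum over [v] of [ln F_v], where [F_v] counts the edges at [v] that may still
   be the block of [v] when [v] is reached. Fix [M] and condition on the time of [v], such
   that another vertex is not earlier with probability [p]. The block of [v] is unrevealed with
   probability [p^2]; any other edge at [v] meets three distinct blocks, and it is free only
   if none of the other eight vertices of these blocks is earlier. Hence the vertex [v] contributes
   at most [p^2 ln (1 + (n/2) p^6)] by Jensen, and the average of this over [p] tends to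
   [ln (n/2) / 3 + 6 \int_0^1 x^2 ln x = (ln (n/2) - 2) / 3]. *)
Require Import Defs.
From Stdlib Require Import Reals.
From mathcomp Require Import all_boot all_order all_algebra Rstruct ring lra zify.

Set Implicit Arguments.
Unset Strict Implicit.
Unset Printing Implicit Defensive.

Import Order.TTheory GRing.Theory Num.Theory.
Local Open Scope ring_scope.
Local Arguments ln x%_ring_scope.
Local Arguments exp x%_ring_scope.

(** * Logarithm inequalities *)

(** This is [1 + y <= exp y] at [y = ln (x / a)]. It is the only form in which the concavity of [ln]
    enters below. *)
Lemma ln_le_tangent (a x : R) : 0 < a -> 0 < x -> ln x <= ln a + x / a - 1.
Proof.
move=> a0 x0; have xa0 : 0 < x / a by rewrite divr_gt0.
have := exp_ineq1_le (ln (x / a)).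
rewrite exp_ln; last exact/RltP.
rewrite -RdivE /Rdiv ln_mult; [|exact/RltP|exact/Rinv_0_lt_compat/RltP].
rewrite ln_Rinv; last exact/RltP.
by move/RleP; rewrite !RealsE => ?; lra.
Qed.

Lemma ln1 : ln 1 = 0.
Proof. exact: ln_1. Qed.

Lemma lnM (x y : R) : 0 < x -> 0 < y -> ln (x * y) = ln x + ln y.
Proof. by move=> /RltP x0 /RltP y0; exact: ln_mult. Qed.

Lemma lnV (x : R) : 0 < x -> ln x^-1 = - ln x.
Proof. by move=> /RltP; exact: ln_Rinv. Qed.

Lemma lnX (x : R) (k : nat) : 0 < x -> ln (x ^+ k) = k%:R * ln x.
Proof. by move=> /RltP x0; rewrite -RpowE ln_pow // INRE. Qed.

Lemma ln_nonpos (x : R) : x <= 0 -> ln x = 0.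
Proof.
by move=> /RleP x0; rewrite /ln; case: Rlt_dec => // x_gt0; case: (Rle_not_lt _ _ x0).
Qed.

Lemma ln_le (x y : R) : 0 < x -> x <= y -> ln x <= ln y.
Proof.
move=> x0; rewrite le_eqVlt => /predU1P[-> //|xy].
by apply/ltW/RltP/ln_increasing; exact/RltP.
Qed.

(** The case [k = 0] survives because of the default value [ln 0 = 0]. *)
Lemma ln_natr_le (k m : nat) : (k <= m)%N -> ln k%:R <= ln m%:R.
Proof.
case: k => [|k km]; last by apply: ln_le; rewrite ?ltr0n ?ler_nat.
rewrite [leLHS]ln_nonpos //; case: m => [|m] _; first by rewrite ln_nonpos.
by rewrite -[leLHS]ln1; apply: ln_le; rewrite ?ltr01 // (ler_nat _ 1).
Qed.

(** * Entropy of a uniformly random perfect matching *)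

(** One step of the chain rule, multiplied by [#|A|]. With [k] the size of the image and [m] that of
    a fibre, take the tangent of [ln] at [k * m]; the errors [#|A| / k - m] cancel when summed over
    the fibres. *)
Lemma card_ln_card_fibers (X C : finType) (f : X -> C) (A : {set X}) :
  #|A|%:R * ln #|A|%:R <= #|A|%:R * ln #|f @: A|%:R +
     \sum_(y in f @: A) #|[set x in A | f x == y]|%:R *
                        ln #|[set x in A | f x == y]|%:R.
Proof.
have [->|[x0 Ax0]] := set_0Vmem A.
  by rewrite imset0 big_set0 cards0 !mul0r addr0.
have sumA : \sum_(y in f @: A) #|[set x in A | f x == y]|%:R = #|A|%:R :> R.
  rewrite -natr_sum; congr (_%:R); rewrite -sum1_card (partition_big_imset f) /=.
  by apply: eq_bigr => y _; rewrite -sum1_card; apply: eq_bigl => x; rewrite inE.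
have k0 : (0 : R) < #|f @: A|%:R.
  by rewrite ltr0n card_gt0; apply/set0Pn; exists (f x0); exact: imset_f.
have a0 : (0 : R) < #|A|%:R by rewrite ltr0n card_gt0; apply/set0Pn; exists x0.
rewrite -{1}sumA mulr_suml.
suff: \sum_(y in f @: A) #|[set x in A | f x == y]|%:R * ln #|A|%:R <=
      \sum_(y in f @: A) (#|[set x in A | f x == y]|%:R * ln #|f @: A|%:R +
         #|[set x in A | f x == y]|%:R * ln #|[set x in A | f x == y]|%:R +
         (#|A|%:R / #|f @: A|%:R - #|[set x in A | f x == y]|%:R)).
  rewrite !big_split /= -!mulr_suml sumrN sumA sumr_const -(mulr_natr #|A|%:R).
  by rewrite mulfK ?gt_eqF // subrr addr0.
apply: ler_sum => _ /imsetP[x Ax ->].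
set m : R := _%:R.
have m0 : 0 < m.
  by rewrite ltr0n card_gt0; apply/set0Pn; exists x; rewrite inE Ax eqxx.
have := ln_le_tangent (mulr_gt0 k0 m0) a0; rewrite lnM // => h.
rewrite -(ler_pM2l m0) in h; apply: (le_trans h); rewrite le_eqVlt; apply/predU1P; left.
by field; rewrite !gt_eqF.
Qed.

(* Chain rule for entropy: [M], uniform on [A], is revealed one coordinate at a time,
   and a variable with at most [k] values has entropy at most [ln k]. *)
Lemma card_ln_card_le_chain (X V C : finType) (c : V -> X -> C) (b : V -> X -> R)
    (s : seq V) (A : {set X}) :
  {in A &, forall M M', (forall v, v \in s -> c v M = c v M') -> M = M'} ->
  (forall p v q, s = p ++ v :: q -> forall M, M \in A ->
     ln #|[set c v M' | M' in [set M' in A | all (fun u => c u M' == c u M) p]]|%:R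
       <= b v M) ->
  #|A|%:R * ln #|A|%:R <= \sum_(M in A) \sum_(v <- s) b v M.
Proof.
elim: s A => [|v s IHs] A injA bA.
  rewrite [leRHS]big1 => [|M _]; last by rewrite big_nil.
  have [->|[x Ax]] := set_0Vmem A; first by rewrite cards0 mul0r.
  suff -> : A = [set x] by rewrite cards1 ln1 mulr0.
  by apply/setP=> y; rewrite inE; apply/idP/eqP => [Ay|-> //]; exact: injA.
apply: le_trans (card_ln_card_fibers (c v) A) _.
under [leRHS]eq_bigr do rewrite big_cons.
rewrite big_split /=; apply: lerD.
  rewrite mulrC mulr_natr -sumr_const; apply: ler_sum => M AM.
  have := bA [::] v s erefl M AM; rewrite /=.
  by have -> : [set M' in A | true] = A by apply/setP => y; rewrite inE andbT.
(* The remaining coordinates are revealed separately inside each fibre of [c v], where the induction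
   hypothesis applies. *)
rewrite [leRHS](partition_big_imset (c v)) /=; apply: ler_sum => y _.
rewrite [leRHS](eq_bigl (mem [set x in A | c v x == y])) /=; last first.
  by move=> x; rewrite !inE.
apply: IHs => [M M'|p w q def_s M].
  rewrite !inE => /andP[AM /eqP cM] /andP[AM' /eqP cM'] cMM'.
  apply: injA => // u; rewrite inE => /predU1P[->|]; [by rewrite cM cM'|exact: cMM'].
rewrite inE => /andP[AM /eqP cM].
have := bA (v :: p) w q _ M AM; rewrite def_s => /(_ erefl).
suff -> : [set M' in A | all (fun u => c u M' == c u M) (v :: p)] =
          [set M' in [set x in A | c v x == y] | all (fun u => c u M' == c u M) p].
  by [].
by apply/setP => M'; rewrite !inE /= cM andbA.
Qed.

(* The block of [v] is revealed at time [t v] unless it is known earlier through another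
   vertex; the edges here are those that may still be that block at that time. The set is empty when the block
   of [v] is revealed before time [t v]; such a vertex costs nothing since [ln 0 = 0]. *)
Definition free_edges (n : nat) (S M : {set {set 'I_n}}) (t : 'I_n -> nat) (v : 'I_n) :
    {set {set 'I_n}} :=
  [set e in S | (v \in e) &&
     [forall u in \bigcup_(x in e) pblock M x, (t v <= t u)%N]].

(** [pblock] sees a block only through its points, so an empty block would go unnoticed. *)
Lemma pblock_perfect_inj (n : nat) (S M M' : {set {set 'I_n}}) :
  set0 \notin S -> perfect_matching S M -> perfect_matching S M' ->
  pblock M =1 pblock M' -> M \subset M'.
Proof.
move=> S0 /and3P[MS tiM _] /and3P[_ _ /eqP cM'] eqM; apply/subsetP => e eM.
have /set0Pn[v ve] : e != set0 by apply: contraNneq S0 => <-; exact: (subsetP MS).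
by rewrite -(def_pblock tiM eM ve) eqM pblock_mem // cM' inE.
Qed.

Lemma perfect_matchings_entropy (n : nat) (S : {set {set 'I_n}}) (t : 'I_n -> nat) :
  set0 \notin S ->
  (num_perfect_matchings S)%:R * ln (num_perfect_matchings S)%:R <=
  \sum_(M : {set {set 'I_n}} | perfect_matching S M)
     \sum_v ln #|free_edges S M t v|%:R.
Proof.
move=> S0; rewrite /num_perfect_matchings; set A := [set M | _].
pose r (u v : 'I_n) := (t u <= t v)%N.
have -> : \sum_(M | perfect_matching S M) \sum_v ln #|free_edges S M t v|%:R =
    \sum_(M in A) \sum_(v <- sort r (enum 'I_n)) ln #|free_edges S M t v|%:R.
  apply: eq_big => [M|M _]; first by rewrite inE.
  by rewrite [RHS](perm_big (enum 'I_n)) ?perm_sort //= big_enum.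
apply: (card_ln_card_le_chain (c := fun v M => pblock M v)).
  move=> M M'; rewrite !inE => PM PM' eqM.
  have {}eqM : pblock M =1 pblock M' by move=> v; rewrite eqM // mem_sort mem_enum.
  apply/eqP; rewrite eqEsubset (pblock_perfect_inj S0 PM PM') //.
  by rewrite (pblock_perfect_inj S0 PM' PM).
move=> p v q def_s M; rewrite inE => /and3P[MS tiM /eqP cM].
(* Ties are sorted arbitrarily; this is harmless because [free_edges] only asks for [t v <= t u]. *)
have later u : u \notin p -> (t v <= t u)%N.
  have : u \in sort r (enum 'I_n) by rewrite mem_sort mem_enum.
  have : sorted r (sort r (enum 'I_n)) by apply: sort_sorted => x y; exact: leq_total.
  rewrite def_s sorted_cat_cons => /andP[_ /order_path_min vq].
  rewrite mem_cat inE => /orP[->//|/predU1P[->//|uq _]].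
  by apply: (allP (vq _) u uq) => x y z; exact: leq_trans.
(* If the block of [v] meets the prefix [p], it is already determined: one value remains, and
   [ln 1 = 0]. *)
have [/hasP[u pu uv]|/hasPn no_early] := boolP (has (mem (pblock M v)) p).
  apply: (@le_trans _ _ (ln 1%:R)); last first.
    by rewrite ln1 -[leLHS](ln_nonpos (lexx 0)); exact: (@ln_natr_le 0).
  apply/ln_natr_le/card_le1_eqP.
  suff blockM M' : M' \in [set M' in A | all (fun u => pblock M' u == pblock M u) p] ->
      pblock M' v = pblock M v.
    by move=> _ _ /imsetP[M1 /blockM + ->] /imsetP[M2 /blockM + ->] => -> ->.
  rewrite !inE => /andP[/and3P[_ tiM' _] /allP/(_ u pu)/eqP eqMu].
  have vu : v \in pblock M' u.
    by rewrite eqMu (same_pblock tiM uv) mem_pblock cM inE.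
  by rewrite (same_pblock tiM' vu) eqMu (same_pblock tiM uv).
apply/ln_natr_le/subset_leq_card/subsetP => _ /imsetP[M' + ->].
rewrite !inE => /andP[/and3P[M'S tiM' /eqP cM'] /allP eqM'].
rewrite (subsetP M'S) ?pblock_mem ?mem_pblock ?cM' ?inE //=.
apply/forall_inP => u /bigcupP[x xv ux]; apply: later.
(* Otherwise [M'] would share with [M] the block of [u], which contains [x]. It would then be the
   [M']-block of [v] too, so [v] would have been revealed through [u]. *)
apply/negP => up; have /eqP eqMu := eqM' u up.
suff vu : v \in pblock M u.
  by have := no_early u up; rewrite /= (same_pblock tiM vu) mem_pblock cM inE.
have xu : x \in pblock M' u.
  by rewrite eqMu (same_pblock tiM ux) mem_pblock cM inE.
by rewrite -eqMu -(same_pblock tiM' xu) (same_pblock tiM' xv) mem_pblock cM' inE.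
Qed.

(** * Edges of a Steiner triple system against the blocks of a matching *)

Lemma steiner_edge_eq (n : nat) (S : {set {set 'I_n}}) (e f : {set 'I_n}) (x y : 'I_n) :
  steiner_triple_system S -> e \in S -> f \in S -> x != y ->
  x \in e -> y \in e -> x \in f -> y \in f -> e = f.
Proof.
move=> [_ SP] eS fS /SP/eqP/cards1P[g defg] xe ye xf yf.
have : e \in [set g] by rewrite -defg inE eS xe ye.
have : f \in [set g] by rewrite -defg inE fS xf yf.
by rewrite !inE => /eqP -> /eqP.
Qed.

(** Double counting: each edge at [v] has two further vertices, and each vertex other than [v] lies
    with [v] in exactly one edge. *)
Lemma steiner_degree (n : nat) (S : {set {set 'I_n}}) (v : 'I_n) :
  steiner_triple_system S -> (2 * #|[set e in S | v \in e]| = n.-1)%N.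
Proof.
move=> [S3 SP]; have -> : n.-1 = #|[set~ v]| by rewrite cardsC1 card_ord.
rewrite mulnC -sum_nat_const.
transitivity (\sum_(e in [set e in S | v \in e]) \sum_(x in [set~ v]) (x \in e : nat))%N.
  apply: eq_bigr => e; rewrite inE => /andP[/S3 e3 ve].
  have := cardsD1 v e; rewrite e3 ve => -[->]; rewrite -sum1_card.
  rewrite [RHS](bigID (mem e)) /= [X in _ = (_ + X)%N]big1 ?addn0; last first.
    by move=> x /andP[_ /negbTE ->].
  apply: eq_big => [x|x]; rewrite !inE // => /andP[_ ->] //.
rewrite exchange_big /= -sum1_card; apply: eq_bigr => x.
rewrite inE in_set1 => xv; rewrite -[RHS](SP v x) 1?eq_sym // -sum1_card.
rewrite [LHS](bigID (fun e : {set 'I_n} => x \in e)) /= [X in (_ + X)%N = _]big1 ?addn0; last first.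
  by move=> e /andP[_ /negbTE ->].
by apply: eq_big => [e|e]; rewrite !inE -?andbA // => /and3P[_ _ ->].
Qed.

Section Blocks.

Variables (n : nat) (S M : {set {set 'I_n}}).
Hypotheses (SP : steiner_triple_system S) (PM : perfect_matching S M).

Lemma mem_pblock_perfect v : v \in pblock M v.
Proof. by case/and3P: PM => _ _ /eqP cM; rewrite mem_pblock cM inE. Qed.

Lemma pblock_perfect_mem v : pblock M v \in M.
Proof. by case/and3P: PM => _ _ /eqP cM; rewrite pblock_mem ?cM ?inE. Qed.

Lemma bigcup_pblock_block v : \bigcup_(x in pblock M v) pblock M x = pblock M v.
Proof.
have /and3P[_ tiM _] := PM.
apply/setP => u; apply/bigcupP/idP => [[x xv]|uv].
  by rewrite (same_pblock tiM xv).
by exists v => //; exact: mem_pblock_perfect.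
Qed.

Lemma card_pblock v : #|pblock M v| = 3%N.
Proof. by have /and3P[/subsetP MS _ _] := PM; apply/SP.1/MS/pblock_perfect_mem. Qed.

(** Two vertices of [e] in a common block would force [e] to be that block, so three disjoint
    triples are met. *)
Lemma card_bigcup_pblock e : e \in S -> e \notin M ->
  #|\bigcup_(x in e) pblock M x| = 9%N.
Proof.
move=> eS eM; have /and3P[/subsetP MS tiM _] := PM.
pose P := [set pblock M x | x in e].
have PsM : P \subset M by apply/subsetP => _ /imsetP[x _ ->]; exact: pblock_perfect_mem.
rewrite -cover_imset -/P; have [_] := leq_card_cover P.
rewrite (trivIsetS PsM tiM) => /eqP ->.
rewrite (eq_bigr (fun=> 3%N)) => [|f /(subsetP PsM)/MS/SP.1 //].
rewrite sum_nat_const card_in_imset ?(SP.1 _ eS) // => x y xe ye eq_xy.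
apply: contraNeq eM => xy; suff -> : e = pblock M x by exact: pblock_perfect_mem.
apply: (steiner_edge_eq SP eS (MS _ (pblock_perfect_mem x)) xy) => //.
  exact: mem_pblock_perfect.
by rewrite eq_xy mem_pblock_perfect.
Qed.

End Blocks.

(** * Random discrete times *)

Lemma card_ord_ge (T s : nat) : #|[pred j : 'I_T | (s <= j)%N]| = (T - s)%N.
Proof.
by rewrite -sum1_card -(big_geq_mkord _ _ xpredT (fun=> 1)) sum_nat_const_nat muln1.
Qed.

(** The event is a product of conditions on single coordinates, so its probability factors: [1 / T]
    for [v], [(T - s) / T] for every other vertex of [Q], and 1 outside [Q]. *)
Lemma prob_revealed_before (n T : nat) (v : 'I_n) (Q : {set 'I_n}) (s : 'I_T) :
  v \in Q ->
  \sum_(t : {ffun 'I_n -> 'I_T} | (t v == s) && [forall u in Q, (s <= t u)%N])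
     (T%:R^-1) ^+ n
  = T%:R^-1 * ((T - s)%:R / T%:R) ^+ #|Q|.-1 :> R.
Proof.
move=> vQ; have T0 : T%:R != 0 :> R by rewrite pnatr_eq0 -lt0n (leq_ltn_trans _ (ltn_ord s)).
pose F u := [pred j : 'I_T | ((u == v) ==> (j == s)) && ((u \in Q) ==> (s <= j)%N)].
have cstE : (T%:R^-1) ^+ n = \prod_(i < n) T%:R^-1 :> R by rewrite prodr_const card_ord.
under eq_bigr do rewrite cstE.
rewrite (eq_bigl (mem (family F))) => [|t]; last first.
  apply/andP/familyP => [[/eqP tv /forall_inP tQ] u|tF].
    rewrite !inE; apply/andP; split; apply/implyP; last exact: tQ.
    by move=> /eqP ->; apply/eqP.
  split; first by have := tF v; rewrite !inE eqxx /= => /andP[].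
  by apply/forall_inP => u uQ; have := tF u; rewrite !inE uQ => /andP[].
rewrite -(bigA_distr_big_dep _ (fun _ _ => T%:R^-1)) /=.
rewrite (bigD1 v) //= (bigID (mem Q)) /= [X in _ * (_ * X)]big1 ?mulr1; last first.
  move=> u /andP[/negbTE uv /negbTE uQ]; rewrite uv uQ /= sumr_const.
  by rewrite card_ord -(mulr_natr T%:R^-1) mulVf.
congr (_ * _).
  rewrite (big_pred1 s) // => j; rewrite eqxx vQ /=.
  by apply: andb_idr => /eqP ->.
rewrite (eq_bigr (fun=> (T - s)%:R / T%:R)) => [|u /andP[/negbTE uv uQ]].
  rewrite prodr_const; congr (_ ^+ _); rewrite (cardsD1 v) vQ /=.
  by apply: eq_card => u; rewrite !inE.
by rewrite uv uQ /= sumr_const -card_ord_ge [RHS]mulrC mulr_natr.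
Qed.

Lemma expected_ln_free_edges (n : nat) (S M : {set {set 'I_n}}) (T : nat) (v : 'I_n) :
  steiner_triple_system S -> perfect_matching S M ->
  \sum_(t : {ffun 'I_n -> 'I_T}) T%:R^-1 ^+ n * ln #|free_edges S M (fun u => t u) v|%:R <=
  \sum_(s < T) T%:R^-1 * ((T - s)%:R / T%:R) ^+ 2 *
               ln (1 + n%:R / 2 * ((T - s)%:R / T%:R) ^+ 6) :> R.
Proof.
move=> SP PM; have /and3P[/subsetP MS tiM _] := PM.
have memv : v \in pblock M v := mem_pblock_perfect PM v.
rewrite (partition_big (fun t : {ffun 'I_n -> 'I_T} => t v) xpredT) //=.
(* Given that the block of [v] is unrevealed, [a] bounds the expected number of free edges: 1 for
   the block itself, and [p ^ 8 / p ^ 2] for each of at most [n / 2] other edges. *)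
apply: ler_sum => s _; set p := (T - s)%:R / T%:R; set a := 1 + _.
set w := _ ^+ n.
have T0 : (0 < T)%N := leq_ltn_trans (leq0n s) (ltn_ord s).
have w0 : 0 <= w by rewrite exprn_ge0 // invr_ge0.
have p0 : 0 <= p by rewrite divr_ge0.
have a1 : 1 <= a by rewrite lerDl mulr_ge0 ?exprn_ge0 // divr_ge0.
have a0 : 0 < a := lt_le_trans ltr01 a1.
pose E (Q : {set 'I_n}) (t : {ffun 'I_n -> 'I_T}) := [forall u in Q, (t v <= t u)%N].
have prE (Q : {set 'I_n}) : v \in Q ->
    \sum_(t : {ffun 'I_n -> 'I_T} | t v == s) w * (E Q t)%:R = T%:R^-1 * p ^+ #|Q|.-1.
  move=> vQ; rewrite -(prob_revealed_before s vQ) big_mkcondr /=.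
  by apply: eq_bigr => t /eqP <-; rewrite /E; case: ifP; rewrite ?mulr1 ?mulr0.
pose e0 := pblock M v; pose Sv := [set e in S | v \in e].
pose U (e : {set 'I_n}) := \bigcup_(x in e) pblock M x.
have e0Sv : e0 \in Sv by rewrite inE memv (MS _ (pblock_perfect_mem PM v)).
have Ue0 : U e0 = e0 by exact: bigcup_pblock_block PM v.
have card_free (t : {ffun 'I_n -> 'I_T}) : #|free_edges S M (fun u => t u) v|%:R = \sum_(e in Sv) (E (U e) t)%:R :> R.
  rewrite -natr_sum -sum1_card; congr _%:R.
  rewrite [RHS](bigID (fun e : {set 'I_n} => E (U e) t)) /= [X in _ = (_ + X)%N]big1 ?addn0; last first.
    by move=> e /andP[_ /negbTE ->].
  by apply: eq_big => [e|e]; rewrite !inE -?andbA // => /and3P[_ _ Ee]; rewrite (_ : E _ _).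
(* The tangent line at [a] plays the role of Jensen's inequality. *)
have bound (t : {ffun 'I_n -> 'I_T}) : ln #|free_edges S M (fun u => t u) v|%:R <=
    (E e0 t)%:R * (ln a - 1) + a^-1 * \sum_(e in Sv) (E (U e) t)%:R.
  rewrite -card_free; case: (posnP #|free_edges S M (fun u => t u) v|) => [N0|N0].
    suff /negbTE -> : ~~ E e0 t by rewrite N0 ln_nonpos // mul0r mulr0 addr0.
    apply/negP => Et; suff : e0 \in free_edges S M (fun u => t u) v by rewrite (cards0_eq N0) inE.
    by move: e0Sv; rewrite !inE => /andP[-> ->]; rewrite /= -/(U e0) Ue0.
  (* Any free edge contains [v], hence its blocks include that of [v], which must then be unrevealed
     too. *)
  have -> : E e0 t.
    have [e] := card_gt0P N0; rewrite inE => /and3P[_ ve /forall_inP Ee].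
    by apply/forall_inP => u ue0; apply: Ee; apply/bigcupP; exists v.
  have := @ln_le_tangent a #|free_edges S M (fun u => t u) v|%:R a0; rewrite ltr0n N0.
  by move=> /(_ isT) h; rewrite mul1r (mulrC a^-1); lra.
apply: (@le_trans _ _ (\sum_(t : {ffun 'I_n -> 'I_T} | t v == s)
    (w * (E e0 t)%:R * (ln a - 1) + a^-1 * \sum_(e in Sv) w * (E (U e) t)%:R))).
  apply: ler_sum => t _; apply: le_trans (ler_wpM2l w0 (bound t)) _.
  by rewrite -mulr_sumr mulrDr [w * (a^-1 * _)]mulrCA !mulrA.
rewrite big_split /= -mulr_suml prE // -mulr_sumr exchange_big /=.
have cardU e : e \in Sv -> e != e0 -> #|U e| = 9%N.
  rewrite inE => /andP[eS ve] ne; apply: (card_bigcup_pblock SP PM eS).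
  by apply: contra ne => eM; rewrite -(def_pblock tiM eM ve).
rewrite (bigD1 e0) //= prE ?Ue0 // (card_pblock SP PM).
rewrite (eq_bigr (fun=> T%:R^-1 * p ^+ 8)) => [|e /andP[eSv ne]]; last first.
  rewrite prE ?cardU //; apply/bigcupP; exists v => //.
  by move: eSv; rewrite inE => /andP[].
rewrite sumr_const; set k := #|_|.
have kn : k%:R <= n%:R / 2 :> R.
  rewrite ler_pdivlMr // -natrM ler_nat mulnC.
  have := steiner_degree v SP; rewrite -/Sv (cardsD1 e0) e0Sv.
  have -> : #|Sv :\ e0| = k by apply: eq_card => e; rewrite in_setD1 andbC.
  lia.
rewrite -(mulr_natr (_ * _)).
have -> : T%:R^-1 * p ^+ 2 * ln a =
   T%:R^-1 * p ^+ 2 * (ln a - 1) + a^-1 * (T%:R^-1 * p ^+ 2 * a).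
  by field; rewrite pnatr_eq0 -lt0n T0 gt_eqF.
rewrite lerD2l ler_pM2l ?invr_gt0 // /a mulrDr mulr1 lerD2l.
rewrite [leRHS](_ : _ = T%:R^-1 * p ^+ 8 * (n%:R / 2)); last by ring.
by rewrite ler_wpM2l // mulr_ge0 ?exprn_ge0 // invr_ge0.
Qed.

(** * Riemann sum estimates *)

Lemma sum_sqr (T : nat) :
  \sum_(j < T) j.+1%:R ^+ 2 = T%:R * (T%:R + 1) * (2 * T%:R + 1) / 6 :> R.
Proof.
elim: T => [|T IHT]; first by rewrite big_ord0 !mul0r.
by rewrite big_ord_recr /= IHT -(natr1 T); field.
Qed.

(* Compares the sum with [T^3 ln T / 3 - T^3 / 9], the integral of [x^2 ln x]. *)
Lemma sum_sqr_ln_le (T : nat) :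
  \sum_(j < T) j.+1%:R ^+ 2 * ln j.+2%:R <=
  T%:R * (T%:R + 1) * (2 * T%:R + 1) / 6 * ln T.+1%:R - T%:R ^+ 3 / 9 + T%:R ^+ 2 :> R.
Proof.
elim: T => [|T IHT]; first by rewrite big_ord0 ln1; lra.
rewrite big_ord_recr /=; set l1 := ln T.+1%:R; set l2 := ln T.+2%:R.
have x0 : 0 <= T%:R :> R by [].
(* Summation by parts: what remains to show is that the sum of squares up to [T], times [l2 - l1],
   covers the growth of [T ^ 3 / 9 - T ^ 2]. *)
have dl : 1 / (T%:R + 2) <= l2 - l1.
  have := @ln_le_tangent T.+2%:R T.+1%:R; rewrite !ltr0n => /(_ isT isT).
  rewrite -/l1 -/l2 -(natr1 T.+1) -(natr1 T) => h.
  have -> : 1 / (T%:R + 2) = 1 - (T%:R + 1) / (T%:R + 1 + 1) :> R.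
    by field; rewrite !gt_eqF //; lra.
  lra.
move: IHT; rewrite -/l1 -(natr1 T); set x : R := T%:R in x0 dl *; move=> IHT.
have : x * (x + 1) * (2 * x + 1) / 6 * (1 / (x + 2)) <=
       x * (x + 1) * (2 * x + 1) / 6 * (l2 - l1).
  by apply: ler_wpM2l => //; rewrite divr_ge0 ?mulr_ge0 //; lra.
have : (3 * x ^+ 2 + 3 * x + 1) / 9 <=
       x * (x + 1) * (2 * x + 1) / 6 * (1 / (x + 2)) + (2 * x + 1).
  rewrite -subr_ge0.
  have -> : x * (x + 1) * (2 * x + 1) / 6 * (1 / (x + 2)) + (2 * x + 1) -
     (3 * x ^+ 2 + 3 * x + 1) / 9 = (27 * x ^+ 2 + 79 * x + 32) / (18 * (x + 2)).
    by field; rewrite !gt_eqF //; lra.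
  by rewrite divr_ge0 //; nra.
by move=> h1 h2; lra.
Qed.

Lemma riemann_sum_le (n T : nat) : (0 < T)%N -> (2 * T ^ 6 <= n)%N ->
  \sum_(s < T) T%:R^-1 * ((T - s)%:R / T%:R) ^+ 2 *
               ln (1 + n%:R / 2 * ((T - s)%:R / T%:R) ^+ 6) <=
  (ln (n%:R / 2) - 2) / 3 + (ln n%:R + 12) / T%:R :> R.
Proof.
move=> T0 Tn; rewrite (reindex_inj rev_ord_inj) /=.
have T0' : 0 < T%:R :> R by rewrite ltr0n.
have T1 : 1 <= T%:R :> R by rewrite (ler_nat _ 1).
have Tn' : 1 <= n%:R / 2 / T%:R ^+ 6 :> R.
  rewrite ler_pdivlMr ?exprn_gt0 // mul1r ler_pdivlMr // -natrX -natrM ler_nat.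
  by rewrite mulnC.
have n2 : 1 <= n%:R / 2 :> R.
  rewrite ler_pdivlMr // mul1r ler_nat (leq_trans _ Tn) // leq_pmulr //.
  by rewrite expn_gt0 T0.
set L := ln (n%:R / 2).
have L0 : 0 <= L by rewrite -[leLHS]ln1; apply: ln_le => //; exact: ltr01.
have Ln : L <= ln n%:R by apply: ln_le; lra.
set r : R := T%:R^-1%R.
have r0 : 0 < r by rewrite invr_gt0.
have rT : r * T%:R = 1 by rewrite mulVf ?gt_eqF.
have r1 : r <= 1 by rewrite invf_le1.
apply: (@le_trans _ _ (\sum_(j < T)
    (r ^+ 3 * (L - 6 * ln T%:R) * j.+1%:R ^+ 2 + r ^+ 3 * 6 * (j.+1%:R ^+ 2 * ln j.+2%:R)))).
  apply: ler_sum => j _; rewrite subKn //.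
  have -> : r ^+ 3 * (L - 6 * ln T%:R) * j.+1%:R ^+ 2 +
      r ^+ 3 * 6 * (j.+1%:R ^+ 2 * ln j.+2%:R) =
      r * (j.+1%:R / T%:R) ^+ 2 * (L + 6 * (ln j.+2%:R - ln T%:R)).
    by rewrite -/r; ring.
  apply: ler_wpM2l; first by rewrite mulr_ge0 ?exprn_ge0 ?divr_ge0 // ltW.
  (* Since [n / (2 * T ^ 6) >= 1], the summand 1 is absorbed by passing from [j + 1] to [j + 2]. *)
  apply: (@le_trans _ _ (ln (n%:R / 2 / T%:R ^+ 6 * j.+2%:R ^+ 6))).
    apply: ln_le; first by rewrite ltr_wpDr // mulr_ge0 ?exprn_ge0 ?divr_ge0.
    set y : R := (n%:R / 2 / T%:R ^+ 6)%R in Tn' *.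
    have -> : n%:R / 2 * (j.+1%:R / T%:R) ^+ 6 = y * j.+1%:R ^+ 6.
      by rewrite /y; field; rewrite gt_eqF.
    have : 1 + j.+1%:R ^+ 6 <= j.+2%:R ^+ 6 :> R.
      rewrite -!natrX nat1r ler_nat ltn_exp2r //.
    have : 0 <= j.+1%:R ^+ 6 :> R by rewrite exprn_ge0.
    nra.
  have -> : n%:R / 2 / T%:R ^+ 6 * j.+2%:R ^+ 6 = n%:R / 2 * (j.+2%:R * T%:R^-1) ^+ 6 :> R.
    by field; rewrite gt_eqF.
  have j2T : 0 < j.+2%:R * T%:R^-1 :> R by rewrite mulr_gt0 // ltr0n.
  rewrite lnM ?exprn_gt0 -/L ?lnX //; last lra.
  by rewrite lnM ?lnV ?invr_gt0 ?ltr0n //; lra.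
rewrite big_split /= -!mulr_sumr sum_sqr.
have := sum_sqr_ln_le T; set X := \sum_(_ < _) _; set l := ln T.+1%:R => hX.
have dl : l - ln T%:R <= r.
  have := @ln_le_tangent T%:R T.+1%:R T0'; rewrite ltr0n -/l => /(_ isT).
  by rewrite -(natr1 T) mulrDl mul1r divff ?gt_eqF // -/r; lra.
have r30 : 0 < r ^+ 3 by rewrite exprn_gt0.
(* The factor [(1 + r) * (2 + r) / 6] tends to [1 / 3], which gives [(L - 2) / 3]. The 12 in the
   error is 6 from [l - ln T <= r] plus 6 from the [T ^ 2] term of [sum_sqr_ln_le]. *)
apply: (@le_trans _ _ ((1 + r) * (2 + r) / 6 * (L + 6 * (l - ln T%:R)) - 6 / 9 + 6 * r)).
  move: hX; rewrite -(ler_pM2l r30) => hX.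
  have e1 : r ^+ 3 * (T%:R * (T%:R + 1) * (2 * T%:R + 1) / 6) = (1 + r) * (2 + r) / 6.
    by rewrite /r; field; rewrite gt_eqF.
  have e2 : r ^+ 3 * T%:R ^+ 3 = 1 by rewrite -exprMn rT expr1n.
  have e3 : r ^+ 3 * T%:R ^+ 2 = r by rewrite exprS -mulrA -exprMn rT expr1n mulr1.
  set c := (1 + r) * (2 + r) / 6 in e1 *.
  have -> : r ^+ 3 * (L - 6 * ln T%:R) * (T%:R * (T%:R + 1) * (2 * T%:R + 1) / 6) =
    c * (L - 6 * ln T%:R) by rewrite -e1; ring.
  have : r ^+ 3 * X <= c * l - 1 / 9 + r.
    apply: (le_trans hX).
    by rewrite mulrDr mulrBr mulrA e1 mulrA e2 e3.
  lra.
have h1 : (1 + r) * (2 + r) / 6 <= 1 / 3 + r by nra.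
have h2 : (1 + r) * (2 + r) / 6 <= 1 by nra.
have h0 : 0 <= (1 + r) * (2 + r) / 6 by nra.
have h3 : (1 + r) * (2 + r) / 6 * L <= (1 / 3 + r) * L by apply: ler_wpM2r.
have h4 : (1 + r) * (2 + r) / 6 * (l - ln T%:R) <= r.
  apply: le_trans (ler_wpM2l h0 dl) _; rewrite -[leRHS]mul1r; apply: ler_wpM2r => //.
  exact: ltW.
have h5 : r * L <= r * ln n%:R by rewrite ler_pM2l.
by rewrite [(_ + 12) / _]mulrC -/r; lra.
Qed.

(** * Averaging over the times and choosing [T] *)

(** Averages the entropy bound over all [T ^ n] time assignments. Exchanging the sums bounds each
    pair of a matching and a vertex by the same quantity. *)
Lemma ln_num_perfect_matchings_le (n : nat) (S : {set {set 'I_n}}) (T : nat) :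
  steiner_triple_system S -> (0 < T)%N -> (2 * T ^ 6 <= n)%N ->
  (0 < num_perfect_matchings S)%N ->
  ln (num_perfect_matchings S)%:R <=
  n%:R * ((ln (n%:R / 2) - 2) / 3 + (ln n%:R + 12) / T%:R).
Proof.
move=> SP T0 Tn N0; set N := (num_perfect_matchings S)%:R; set B := _ + _.
have N0' : 0 < N by rewrite ltr0n.
rewrite -(ler_pM2l N0'); pose w : R := (T%:R^-1 ^+ n)%R.
have w0 : 0 <= w by rewrite exprn_ge0 // invr_ge0.
have w1 : \sum_(t : {ffun 'I_n -> 'I_T}) w = 1.
  rewrite sumr_const card_ffun !card_ord -(mulr_natr w) natrX -exprMn.
  by rewrite mulVf ?expr1n // pnatr_eq0 -lt0n.
have S0 : set0 \notin S by apply/negP => /SP.1; rewrite cards0.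
rewrite -[leLHS]mul1r -[X in X * _ <= _]w1 mulr_suml.
apply: (@le_trans _ _ (\sum_(t : {ffun 'I_n -> 'I_T}) \sum_(M | perfect_matching S M)
   \sum_v w * ln #|free_edges S M (fun u => t u) v|%:R)).
  apply: ler_sum => t _.
  apply: le_trans (ler_wpM2l w0 (perfect_matchings_entropy (fun u => t u) S0)) _.
  by rewrite mulr_sumr; under [leLHS]eq_bigr do rewrite mulr_sumr.
rewrite exchange_big /=.
apply: (@le_trans _ _ (\sum_(M | perfect_matching S M) n%:R * B)).
  apply: ler_sum => M PM; rewrite exchange_big /=.
  apply: (@le_trans _ _ (\sum_(v < n) B)).
    apply: ler_sum => v _; apply: le_trans (expected_ln_free_edges T v SP PM) _.
    exact: riemann_sum_le.
  by rewrite sumr_const card_ord mulr_natl.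
rewrite sumr_const -(mulr_natl (n%:R * B)) /N /num_perfect_matchings.
rewrite le_eqVlt; apply/predU1P; left; congr (_%:R * _).
by apply: eq_card => M; rewrite inE.
Qed.

(** Covers the orders for which no positive [T] satisfies [2 * T ^ 6 <= n]; no triple fits there. *)
Lemma num_perfect_matchings_le1 (n : nat) (S : {set {set 'I_n}}) :
  steiner_triple_system S -> (n <= 1)%N -> (num_perfect_matchings S <= 1)%N.
Proof.
move=> SP n1; apply/card_le1_eqP.
suff M0 M : M \in [set M | perfect_matching S M] -> M = set0 by move=> M M' /M0 -> /M0 ->.
rewrite inE => /and3P[/subsetP MS _ _]; apply: contraTeq n1 => /set0Pn[e /MS/SP.1 e3].
by have := max_card e; rewrite e3 card_ord; case: n {S SP M MS e e3} => [|[]].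
Qed.

Lemma ln2_le1 : ln 2 <= 1.
Proof.
have := @ln_le_tangent 1%R 2%R; rewrite ltr01 ltr0n => /(_ isT isT).
by rewrite ln1; lra.
Qed.

(* With [m = trunc_log 64 (n / 2)], [T = 2 ^ m] is the sixth root of [n / 2] up to a
   bounded factor. *)
Definition rate (n : nat) : R := (3 * (ln n%:R + 12) / (2 ^ trunc_log 64 n./2)%:R)%R.

Lemma rate_ge0 (n : nat) : 0 <= rate n.
Proof.
rewrite divr_ge0 // mulr_ge0 // addr_ge0 // -[leLHS](ln_nonpos (lexx 0)).
exact: (@ln_natr_le 0).
Qed.

Lemma num_perfect_matchings_le (n : nat) (S : {set {set 'I_n}}) :
  steiner_triple_system S ->
  (num_perfect_matchings S)%:R <= exp (n%:R / 3 * (rate n + ln (n%:R / 2) - 2)) :> R.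
Proof.
move=> SP; have exp_mono (x y : R) : x <= y -> exp x <= exp y.
  rewrite le_eqVlt => /predU1P[-> //|/RltP xy].
  by apply/ltW/RltP; exact: exp_increasing.
have [n1|n2] := leqP n 1.
  apply: (@le_trans _ _ 1).
    by rewrite (ler_nat _ _ 1); exact: num_perfect_matchings_le1.
  rewrite -[leLHS](_ : exp 0 = 1); last exact: exp_0.
  apply: exp_mono.
  case: n n1 {S SP} => [|[|//]] _; first by rewrite !mul0r.
  (* At [n = 1] the rate is 36, which outweighs [- ln 2 - 2]. *)
  have -> : ln (1%:R / 2) = - ln 2 by rewrite div1r lnV ?ltr0n.
  by rewrite /rate (_ : trunc_log _ _ = 0%N) // expn0 ln1; have := ln2_le1; lra.
have [->|N0] := posnP (num_perfect_matchings S); first exact/ltW/RltP/exp_pos.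
rewrite -[leLHS]exp_ln; last by apply/RltP; rewrite ltr0n.
apply: exp_mono; pose T := (2 ^ trunc_log 64 n./2)%N.
have T0 : (0 < T)%N by rewrite expn_gt0.
have n2' : (0 < n./2)%N by lia.
have Tn : (2 * T ^ 6 <= n)%N.
  have /andP[] := @trunc_log_bounds 64 n./2 isT n2'.
  rewrite /T -expnM (mulnC _ 6) (expnM 2 6) -[(2 ^ 6)%N]/64%N => h _; lia.
apply: le_trans (ln_num_perfect_matchings_le SP T0 Tn N0) _.
rewrite le_eqVlt; apply/predU1P; left; rewrite /rate -/T.
by field; rewrite pnatr_eq0 -lt0n.
Qed.

Lemma sqrn_le_expn2 (m : nat) : (m.+1 ^ 2 <= 4 * 2 ^ m)%N.
Proof.
case: m => [//|[//|m]]; elim: m => [//|m IHm].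
rewrite -!mulnn in IHm *; rewrite (expnS 2 m.+2).
by move: (2 ^ m.+2)%N IHm => x; nia.
Qed.

(** From [n < 2 * 64 ^ (m + 1)] comes [ln n <= 6 * m + 7], and [2 ^ m >= (m + 1) ^ 2 / 4]. So the
    rate is at most [12 * (6 * m + 19) / (m + 1) ^ 2], and [12 * 19 = 228]. *)
Lemma rate_le (n : nat) : (2 <= n)%N -> rate n <= 228 / (trunc_log 64 n./2).+1%:R.
Proof.
move=> n2; rewrite /rate; set m := trunc_log _ _.
have lnn : ln n%:R <= 6 * m%:R + 7.
  have n2' : (0 < n./2)%N by lia.
  have /andP[_] := @trunc_log_bounds 64 n./2 isT n2'.
  rewrite -/m => nm; have {}nm : (n <= 2 ^ (6 * m + 7))%N.
    rewrite expnS in nm; rewrite expnD expnM -[(2 ^ 6)%N]/64%N -[(2 ^ 7)%N]/128%N; lia.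
  apply: le_trans (ln_natr_le nm) _; rewrite natrX lnX ?ltr0n //.
  by have := ln2_le1; rewrite natrD natrM => ?; have : 0 <= m%:R :> R by []; nra.
have m0 : 0 <= m%:R :> R by [].
have m2 : (m%:R + 1) ^+ 2 <= 4 * (2 ^ m)%:R :> R.
  by rewrite natr1 -natrX -natrM ler_nat sqrn_le_expn2.
have T0 : 0 < (2 ^ m)%:R :> R by rewrite ltr0n expn_gt0.
rewrite ler_pdivrMr // -natr1 mulrAC ler_pdivlMr; last lra.
nra.
Qed.

Lemma rate_cvg : Un_cv (fun n => exp (rate n) - 1)%R 0%R.
Proof.
move=> eps /RltP eps0.
have y0 : 0 < ln (1 + eps).
  by rewrite -[ltLHS]ln1; apply/RltP/ln_increasing; apply/RltP; rewrite ?ltrDl // ltr01.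
pose m0 := Num.bound (228 / ln (1 + eps)); exists (2 * 64 ^ m0 + 2)%N => n nN.
have n2 : (2 <= n)%N by lia.
have m0_le : (m0 <= trunc_log 64 n./2)%N by apply: trunc_log_max => //; lia.
have rate_lt : rate n < ln (1 + eps).
  apply: le_lt_trans (rate_le n2) _; rewrite ltr_pdivrMr ?ltr0n // mulrC -ltr_pdivrMr //.
  apply: lt_le_trans (archi_boundP _) _; first by rewrite divr_ge0 // ltW.
  by rewrite ler_nat ltnW.
have exp_lt : exp (rate n) < 1 + eps.
  rewrite -[ltRHS]exp_ln; last by apply/RltP; rewrite addr_gt0.
  by apply/RltP/exp_increasing/RltP.
have exp_ge : 1 <= exp (rate n).
  have /RleP := exp_ineq1_le (rate n); rewrite !RealsE; apply: le_trans.
  by rewrite lerDl rate_ge0.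
by apply/RltP; rewrite RdistE subr0 ger0_norm ?subr_ge0 // ltrBlDl.
Qed.

(** With [1 + eta = exp x], an additive error [x] in the exponent becomes a factor of the base. *)
Lemma ln_base (x : R) (n : nat) : (0 < n)%N ->
  ln ((1 + (exp x - 1)) * n%:R / (2 * exp 2)) = x + ln (n%:R / 2) - 2.
Proof.
move=> n0; have exp_gt0 y : 0 < exp y by apply/RltP; exact: exp_pos.
rewrite addrC subrK -mulrA invfM [n%:R * _]mulrA !lnM ?lnV ?ln_exp //.
- by ring.
all: by rewrite ?divr_gt0 ?invr_gt0 ?ltr0n.
Qed.

Local Close Scope ring_scope.
Delimit Scope R_scope with R.
Local Arguments exp x%_R_scope.

Theorem theorem1p2 :
  exists eta : nat -> R,
    Un_cv eta 0%R /\
    forall (n : nat) (S : {set {set 'I_n}}),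
      steiner_triple_system S ->
      (INR (num_perfect_matchings S) <=
       Rpower ((1 + eta n) * INR n / (2 * exp 2)) (INR n / 3))%R.
Proof.
exists (fun n => exp (rate n) - 1)%R; split; first exact: rate_cvg.
move=> n S SP; apply/RleP; rewrite INRE.
apply: le_trans (num_perfect_matchings_le SP) _; rewrite le_eqVlt; apply/predU1P; left.
rewrite /Rpower; congr exp; rewrite RmultE RdivE INRE.
(* At [n = 0] the exponent vanishes on both sides, whatever [ln] returns at 0. *)
have [->|n0] := posnP n; first by rewrite !mul0r.
by rewrite !RealsE /= ln_base.
Qed.
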